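(* Consider the rAA(1) residual iteration (defined in the context) applied to a symmetric matrix $M\in\mathbb{R}^{2\times2}$, where $M\neq0$ and $A:=I-M$ is invertible. Let $\mathbf{r}_0=c_1\mathbf{v}_1+c_2\mathbf{v}_2$ be the initial residual with $c_1,c_2\in\mathbb{R}$, and with $\mathbf{v}_1,\mathbf{v}_2$ two orthogonal eigenvectors of $M$ with eigenvalues $m_1$ and $m_2$, respectively. Let $\varrho_{\rm AA}(\mathbf{r}_0)$ be the $\mathbf{r}_0$-specific root-convergence factor of the iteration. Suppose that $c_1=0$ or $c_2=0$. Then, $$\varrho_{\rm AA}(\mathbf{r}_0)=0.$$ Otherwise, suppose that $c_1,c_2\neq0$ and let $\varepsilon:=c_2/c_1$, so that $\mathbf{r}_0\propto\mathbf{v}_1+\varepsilon\mathbf{v}_2$. Then, $$\varrho_{\rm AA}(\mathbf{r}_0)=\left[\frac{(m_2-m_1)^2}{(m_1-1)^2+\varepsilon^2(m_2-1)^2}\cdot\frac{(m_1m_2)^2}{m_1^2+\dfrac{m_2^2}{\varepsilon^2}}\right]^{1/4}.$$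
   Context: Let $\langle\cdot,\cdot\rangle$ be the Euclidean inner product and $\|\cdot\|$ the $\ell^2$-norm. With $A:=I-M$ invertible, define for $\mathbf{v}\neq\mathbf{0}$ $$\alpha(\mathbf{v}):=\frac{\langle A\mathbf{v},\mathbf{v}\rangle}{\langle A\mathbf{v},A\mathbf{v}\rangle},\qquad \mathcal{R}(\mathbf{v}):=M\,[I-\alpha(\mathbf{v})A]\,\mathbf{v}.$$ The rAA(1) residual iteration (restarted Anderson acceleration with restart size one for the fixed-point map $\mathbf{x}\mapsto M\mathbf{x}+\mathbf{b}$) started from $\mathbf{r}_0$ generates residuals by $\mathbf{r}_{k+1}=M\mathbf{r}_k$ for $k=0,2,4,\dots$ and $\mathbf{r}_{k+1}=\mathcal{R}(\mathbf{r}_{k-1})$ for $k=1,3,5,\dots$. A zero residual means the exact solution has been found, at which point the iteration is halted (the residual is then regarded as staying zero). Root-convergence factor: for an iterative method producing a sequence of residual vectors $\{\mathbf{r}_k\}\subset\mathbb{R}^n$ converging to zero, the root-convergence factor is $\varrho(\mathbf{r}_0):=\limsup_{k\to\infty}\|\mathbf{r}_k\|^{1/k}$.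
   Formalization: In the case where c1 and c2 are both nonzero, the eigenvectors v1 and v2 are additionally assumed to have equal Euclidean norm; without this the formula in ε fails, since rescaling v2 changes ε but not the iteration. *)

(* Defs.v *)
From HB Require Import structures.
From mathcomp Require Import all_boot all_order all_algebra.
From mathcomp Require Import all_classical all_reals all_analysis.

Set Implicit Arguments.
Unset Strict Implicit.
Unset Printing Implicit Defensive.

Import Order.TTheory GRing.Theory Num.Theory.

Local Open Scope ring_scope.

Definition dotv (R : realType) (n : nat) (u v : 'cV[R]_n) : R :=
  \sum_(i < n) u i 0 * v i 0.

(* The norm that MathComp-Analysis puts on matrices is the sup norm, hence
   this separate Euclidean norm. *)
Definition l2norm (R : realType) (n : nat) (v : 'cV[R]_n) : R :=
  Num.sqrt (dotv v v).

Definition is_eigenvector (R : realType) (n : nat) (M : 'M[R]_n) (m : R)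
  (v : 'cV[R]_n) : Prop := v != 0 /\ M *m v = m *: v.

Definition AA_alpha (R : realType) (n : nat) (M : 'M[R]_n) (v : 'cV[R]_n) : R :=
  let A := 1%:M - M in dotv (A *m v) v / dotv (A *m v) (A *m v).

Definition AA_step (R : realType) (n : nat) (M : 'M[R]_n) (v : 'cV[R]_n) :
  'cV[R]_n := let A := 1%:M - M in M *m (1%:M - AA_alpha M v *: A) *m v.

(* The test r == 0 is the halting rule: once a residual vanishes, all the
   later ones are zero. *)
Fixpoint rAA1 (R : realType) (n : nat) (M : 'M[R]_n) (r0 : 'cV[R]_n) (k : nat) :
  'cV[R]_n :=
  if k is k'.+1 then
    let r := rAA1 M r0 k' in
    if r == 0 then 0
    else if odd k' then AA_step M (rAA1 M r0 k'.-1) else M *m r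
  else r0.

(* The limsup is taken in the extended reals, so that it is meaningful without
   a boundedness assumption. The exponent at k = 0 is 0^-1 = 0; this term does
   not affect the limsup. *)
Definition root_conv_factor (R : realType) (n : nat) (r : nat -> 'cV[R]_n) :
  \bar R := limn_esup (fun k => (l2norm (r k) `^ k%:R^-1)%:E).

(* Main.v *)
Require Import Defs.
From HB Require Import structures.
From mathcomp Require Import all_boot all_order all_algebra.
From mathcomp Require Import all_classical all_reals all_analysis.
From mathcomp Require Import ring.

Set Implicit Arguments.
Unset Strict Implicit.
Unset Printing Implicit Defensive.

Import Order.TTheory GRing.Theory Num.Theory.
Import numFieldNormedType.Exports.
Local Open Scope classical_set_scope.
Local Open Scope ring_scope.

(** Two steps of the residual map R act as a scalar, which makes the iteration
    periodic up to a factor.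

    Write a residual as r = a v1 + b v2 with v1, v2 orthogonal eigenvectors, put
    p = m1 - 1, q = m2 - 1, s_i = |v_i|^2 and D = (p a)^2 s1 + (q b)^2 s2.
    The minimizing step length alpha makes I - alpha A send (a, b) to
    a b (m2 - m1) / D times (q b s2, - p a s1): the vector A r is turned by a
    right angle, up to the metric (s1, s2). After multiplication by M this is
    [AA_step_orth]. Applying it twice turns by two right angles, so the
    direction comes back (M enters twice with coordinates exchanged, so it only
    contributes the factor m1 m2), and [AA_step_twice] gives R (R r) = kappa r, with
    kappa >= 0 depending on r only through its direction. For s1 = s2 it is the
    quantity under the fourth root in the theorem.

    Since R is homogeneous of degree one ([AA_stepZ]), every residual then
    satisfies r_(k+4) = kappa r_k ([rAA1_period4]); halting is consistent with
    this, because R r = (I - alpha A) (M r) already vanishes when M r does.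
    If kappa = 0 the iteration ends in exact zeros; this covers initial
    residuals along one eigenvector, as kappa contains the factor (a b)^2.
    If kappa > 0, no residual vanishes and |r_k| / kappa^(k/4) is a positive
    periodic sequence, hence bounded away from 0 and infinity, and its k-th
    roots tend to 1 ([root_conv_factor_periodic]). *)

(** * Euclidean inner product and norm *)

Lemma dotvDZ_orth (R : realType) (n : nat) (v1 v2 : 'cV[R]_n) (a b c d : R) :
  dotv v1 v2 = 0 ->
  dotv (a *: v1 + b *: v2) (c *: v1 + d *: v2) =
    a * c * dotv v1 v1 + b * d * dotv v2 v2.
Proof.
move=> orth.
have -> : a * c * dotv v1 v1 + b * d * dotv v2 v2 =
    a * c * dotv v1 v1 + (a * d + b * c) * dotv v1 v2 + b * d * dotv v2 v2.
  by rewrite orth; ring.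
rewrite /dotv !mulr_sumr -!big_split /=; apply: eq_bigr => i _.
by rewrite !mxE; ring.
Qed.

Lemma dotvZ (R : realType) (n : nat) (v w : 'cV[R]_n) (c d : R) :
  dotv (c *: v) (d *: w) = c * d * dotv v w.
Proof. by rewrite /dotv mulr_sumr; apply: eq_bigr => i _; rewrite !mxE; ring. Qed.

Lemma dotv_ge0 (R : realType) (n : nat) (v : 'cV[R]_n) : 0 <= dotv v v.
Proof. by apply: sumr_ge0 => i _; rewrite -expr2 sqr_ge0. Qed.

Lemma dotv_eq0 (R : realType) (n : nat) (v : 'cV[R]_n) :
  (dotv v v == 0) = (v == 0).
Proof.
apply/eqP/eqP => [v0|->]; last by rewrite /dotv big1 // => i _; rewrite !mxE mul0r.
apply/colP => i; rewrite mxE; apply/eqP; rewrite -(orbb (v i 0 == 0)) -mulf_eq0.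
apply/eqP; apply: (psumr_eq0P _ v0) => // j _; rewrite -expr2; exact: sqr_ge0.
Qed.

Lemma l2normZ (R : realType) (n : nat) (c : R) (v : 'cV[R]_n) :
  l2norm (c *: v) = `|c| * l2norm v.
Proof. by rewrite /l2norm dotvZ -expr2 sqrtrM ?sqr_ge0 // sqrtr_sqr. Qed.

Lemma l2norm_gt0 (R : realType) (n : nat) (v : 'cV[R]_n) : v != 0 -> 0 < l2norm v.
Proof. by move=> v0; rewrite sqrtr_gt0 lt_def dotv_eq0 v0 dotv_ge0. Qed.

Lemma l2norm0 (R : realType) (n : nat) : l2norm (0 : 'cV[R]_n) = 0.
Proof. by rewrite -(scale0r 0) l2normZ normr0 mul0r. Qed.

(** * Root-convergence factors *)

Lemma root_conv_factor_cvg (R : realType) (n : nat) (r : nat -> 'cV[R]_n) (l : R) :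
  (fun k => l2norm (r k) `^ k%:R^-1) @ \oo --> l -> root_conv_factor r = l%:E.
Proof.
move=> rl; suff /cvg_limn_einf_sup[_] :
  (fun k => (l2norm (r k) `^ k%:R^-1)%:E) @ \oo --> l%:E by [].
exact: (cvg_comp _ _ rl).
Qed.

Lemma root_conv_factor_eventually0 (R : realType) (n : nat) (r : nat -> 'cV[R]_n)
    (N : nat) :
  (forall k, (N <= k)%N -> r k = 0) -> root_conv_factor r = 0%:E.
Proof.
move=> r0; apply: root_conv_factor_cvg; apply: cvg_near_cst.
near=> k; rewrite r0; last by near: k; exact: nbhs_infty_ge.
rewrite l2norm0 powR0// invr_eq0 pnatr_eq0 -lt0n; near: k.
exact: nbhs_infty_gt.
Unshelve. all: by end_near. Qed.

Lemma periodic_mod (T : Type) (p : nat) (f : nat -> T) :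
  (forall k, f (k + p)%N = f k) -> forall k, f k = f (k %% p)%N.
Proof.
move=> fp k; rewrite {1}(divn_eq k p) addnC.
elim: (k %/ p)%N => [|j IH]; first by rewrite addn0.
by rewrite mulSn [(p + _)%N]addnC addnA fp.
Qed.

(** The sequence s_k = |r_k| / rho^k, with rho = kappa^(1/p), is p-periodic and
    positive, so ln s_k is bounded and ln s_k / k tends to 0; hence
    |r_k|^(1/k) = rho exp (ln s_k / k) tends to rho. *)
Lemma root_conv_factor_periodic (R : realType) (n p : nat) (kappa : R)
    (r : nat -> 'cV[R]_n) : (0 < p)%N -> 0 < kappa ->
  (forall k, r k != 0) -> (forall k, r (k + p)%N = kappa *: r k) ->
  root_conv_factor r = (kappa `^ p%:R^-1)%:E.
Proof.
move=> p_gt0 kappa_gt0 r_neq0 rS.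
set rho := kappa `^ p%:R^-1.
have rho_gt0 : 0 < rho by exact: powR_gt0.
have rhoXp : rho ^+ p = kappa.
  rewrite -powR_mulrn ?ltW// -powRrM mulVf ?pnatr_eq0 -?lt0n//.
  by rewrite powRr1// ltW.
pose s k := l2norm (r k) / rho ^+ k.
have s_gt0 k : 0 < s k by rewrite divr_gt0 ?l2norm_gt0 ?exprn_gt0.
have sS k : s (k + p)%N = s k.
  rewrite /s rS l2normZ gtr0_norm// exprD rhoXp [_ * kappa]mulrC -mulf_div.
  by rewrite divff ?gt_eqF// mul1r.
pose C := \sum_(i < p) `|ln (s i)|.
have lns k : `|ln (s k)| <= C.
  rewrite (periodic_mod sS) /C (bigD1 (Ordinal (ltn_pmod k p_gt0)))//=.
  by rewrite lerDl sumr_ge0.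
have lim0 : (fun k => ln (s k) / k%:R) @ \oo --> (0 : R).
  apply/norm_cvg0P.
  apply: (@squeeze_cvgr _ _ _ _ (fun=> 0) (fun k => C * k%:R^-1)).
  - near=> k; rewrite normr_ge0 normrM [`|_^-1|]ger0_norm ?invr_ge0//=.
    by rewrite ler_wpM2r// invr_ge0.
  - exact: cvg_cst.
  - rewrite -[X in _ --> X](mulr0 C); apply: cvgMl_tmp.
    by rewrite -(cvg_shiftS (fun k => k%:R^-1 : R)); exact: cvg_harmonic.
apply: root_conv_factor_cvg.
have : (fun k => expR (ln (s k) / k%:R) * rho) @ \oo --> rho.
  rewrite -[X in _ --> X]mul1r -[in X in _ --> X]expR0; apply: cvgMr_tmp.
  exact: (cvg_comp _ _ lim0 (@continuous_expR R 0)).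
apply: cvg_trans; apply: near_eq_cvg; near=> k.
have k0 : k%:R != 0 :> R by rewrite pnatr_eq0 -lt0n; near: k; exact: nbhs_infty_gt.
have -> : l2norm (r k) = s k * rho ^+ k by rewrite /s divfK// expf_neq0// gt_eqF.
rewrite powRM ?ltW ?exprn_gt0// -powR_mulrn ?ltW// -powRrM mulfV// powRr1 ?ltW//.
by rewrite /powR gt_eqF ?s_gt0// [k%:R^-1 * _]mulrC.
Unshelve. all: by end_near. Qed.

(** * The residual map and the iteration *)

(** M commutes with A, so R v depends on v only through M v and alpha. *)
Lemma AA_stepE (R : realType) (n : nat) (M : 'M[R]_n) (v : 'cV[R]_n) :
  AA_step M v = M *m v - AA_alpha M v *: (M *m v - M *m (M *m v)).
Proof.
rewrite /AA_step -mulmxA mulmxBl mul1mx mulmxBr -scalemxAl -scalemxAr.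
by rewrite mulmxBl mul1mx mulmxBr.
Qed.

(** The coefficient alpha is a ratio of two quadratic forms, so it ignores scaling. *)
Lemma AA_stepZ (R : realType) (n : nat) (M : 'M[R]_n) (c : R) (v : 'cV[R]_n) :
  AA_step M (c *: v) = c *: AA_step M v.
Proof.
have [->|c0] := eqVneq c 0.
  by rewrite !scale0r AA_stepE !mulmx0 subr0 scaler0 subr0.
have alphaZ : AA_alpha M (c *: v) = AA_alpha M v.
  by rewrite /AA_alpha -scalemxAr !dotvZ -mulf_div divff ?mul1r// mulf_neq0.
rewrite !AA_stepE alphaZ -!scalemxAr -scalerBr scalerA mulrC -scalerA.
by rewrite -scalerBr.
Qed.

Lemma AA_step_ker (R : realType) (n : nat) (M : 'M[R]_n) (v : 'cV[R]_n) :
  M *m v = 0 -> AA_step M v = 0.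
Proof. by move=> Mv; rewrite AA_stepE Mv mulmx0 subr0 scaler0 subr0. Qed.

Lemma rAA1_odd (R : realType) (n : nat) (M : 'M[R]_n) (r0 : 'cV[R]_n) (k : nat) :
  ~~ odd k -> rAA1 M r0 k.+1 = M *m rAA1 M r0 k.
Proof. by move=> /negbTE /= ->; case: eqP => // ->; rewrite mulmx0. Qed.

(** The halting test disappears from the two-step recurrence: a zero residual
    r_(k+1) = M r_k forces R r_k = 0. *)
Lemma rAA1_even (R : realType) (n : nat) (M : 'M[R]_n) (r0 : 'cV[R]_n) (k : nat) :
  ~~ odd k -> rAA1 M r0 k.+2 = AA_step M (rAA1 M r0 k).
Proof.
move=> ek; have Mr := rAA1_odd M r0 ek.
rewrite -[LHS]/(if rAA1 M r0 k.+1 == 0 then 0 else if odd k.+1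
  then AA_step M (rAA1 M r0 k) else M *m rAA1 M r0 k.+1).
rewrite oddS ek Mr; case: eqP => // /AA_step_ker -> //.
Qed.

Lemma rAA1_halt (R : realType) (n : nat) (M : 'M[R]_n) (r0 : 'cV[R]_n) (j k : nat) :
  (j <= k)%N -> rAA1 M r0 j = 0 -> rAA1 M r0 k = 0.
Proof.
move=> /subnK <- rj; elim: (k - j)%N => //= i IH.
by rewrite IH eqxx.
Qed.

(** Homogeneity carries the scalar action of R o R from r_0 to all even residuals,
    and odd residuals are images of even ones under M. *)
Lemma rAA1_period4 (R : realType) (n : nat) (M : 'M[R]_n) (r0 : 'cV[R]_n) (kappa : R) :
  AA_step M (AA_step M r0) = kappa *: r0 ->
  forall k, rAA1 M r0 (k + 4) = kappa *: rAA1 M r0 k.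
Proof.
move=> step2.
have even j : rAA1 M r0 (j.*2 + 4) = kappa *: rAA1 M r0 j.*2.
  elim: j => [|j IH]; first by rewrite !rAA1_even.
  rewrite doubleS !addSn rAA1_even ?oddD ?odd_double// IH AA_stepZ.
  by rewrite -rAA1_even ?odd_double.
move=> k; rewrite -(odd_double_half k); case: (odd k); last exact: even.
rewrite -addnA !add1n !rAA1_odd ?oddD ?odd_double// even.
by rewrite scalemxAr.
Qed.

Lemma root_conv_factor_rAA1_eq0 (R : realType) (n : nat) (M : 'M[R]_n)
    (r0 : 'cV[R]_n) :
  AA_step M (AA_step M r0) = 0 -> root_conv_factor (rAA1 M r0) = 0%:E.
Proof.
move=> step2; apply: (@root_conv_factor_eventually0 _ _ _ 4) => k k4.
apply: rAA1_halt k4 _; rewrite -[4%N]add0n (@rAA1_period4 _ _ _ _ 0) ?scale0r//.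
Qed.

(** For kappa > 0 no residual can vanish: halting would kill r_(4j) = kappa^j r_0
    for large j. *)
Lemma root_conv_factor_rAA1 (R : realType) (n : nat) (M : 'M[R]_n) (r0 : 'cV[R]_n)
    (kappa : R) : 0 <= kappa -> r0 != 0 ->
  AA_step M (AA_step M r0) = kappa *: r0 ->
  root_conv_factor (rAA1 M r0) = (kappa `^ 4%:R^-1)%:E.
Proof.
rewrite le_eqVlt => /predU1P[<- _ step2|kappa_gt0 r0_neq0 step2].
  rewrite powR0 ?invr_eq0 ?pnatr_eq0//; apply: root_conv_factor_rAA1_eq0.
  by rewrite step2 scale0r.
apply: root_conv_factor_periodic => // k; last exact: rAA1_period4.
have r4 j : rAA1 M r0 (j * 4) = kappa ^+ j *: r0.
  elim: j => [|j IH]; first by rewrite scale1r.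
  by rewrite mulSn addnC (rAA1_period4 step2) IH scalerA exprS.
apply/eqP => rk; have := r4 k; rewrite (rAA1_halt (leq_pmulr k _) rk)//.
by move=> /esym/eqP; rewrite scaler_eq0 expf_eq0 (gt_eqF kappa_gt0) andbF (negbTE r0_neq0).
Qed.

(** * Scalar action of two steps in an eigenbasis *)

(** With alpha written out, 1 - alpha (1 - m1) is a multiple of b^2 and
    1 - alpha (1 - m2) is a multiple of a^2, with opposite signs; the common
    factor a b then comes out, leaving coordinates with a and b exchanged. If
    D = 0 then a = b = 0 and both sides vanish. *)
Lemma AA_step_orth (R : realType) (n : nat) (M : 'M[R]_n) (m1 m2 a b : R)
    (v1 v2 : 'cV[R]_n) :
  let s1 := dotv v1 v1 in let s2 := dotv v2 v2 in
  let D := ((m1 - 1) * a) ^+ 2 * s1 + ((m2 - 1) * b) ^+ 2 * s2 in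
  m1 != 1 -> m2 != 1 ->
  is_eigenvector M m1 v1 -> is_eigenvector M m2 v2 -> dotv v1 v2 = 0 ->
  AA_step M (a *: v1 + b *: v2) =
    (a * b * (m2 - m1) / D) *:
      ((m1 * (m2 - 1) * b * s2) *: v1 + (- (m2 * (m1 - 1) * a * s1)) *: v2).
Proof.
move=> s1 s2 D m1_neq1 m2_neq1 [v1_neq0 e1] [v2_neq0 e2] orth.
have [/eqP D0|D0] := eqVneq D 0.
  have s1_neq0 : s1 != 0 by rewrite dotv_eq0.
  have s2_neq0 : s2 != 0 by rewrite dotv_eq0.
  move: D0; rewrite paddr_eq0 ?(mulr_ge0 (sqr_ge0 _) (dotv_ge0 _))//.
  rewrite !mulf_eq0 !subr_eq0 (negbTE m1_neq1) (negbTE m2_neq1).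
  rewrite (negbTE s1_neq0) (negbTE s2_neq0) /= !orbF !orbb => /andP[/eqP-> /eqP->].
  by rewrite !mul0r !scale0r addr0 AA_step_ker// mulmx0.
have MZ x y : M *m (x *: v1 + y *: v2) = (m1 * x) *: v1 + (m2 * y) *: v2.
  by rewrite mulmxDr -!scalemxAr e1 e2 !scalerA ![_ * m1]mulrC ![_ * m2]mulrC.
have alphaE : AA_alpha M (a *: v1 + b *: v2) =
    - ((m1 - 1) * a ^+ 2 * s1 + (m2 - 1) * b ^+ 2 * s2) / D.
  rewrite /AA_alpha mulmxBl mul1mx MZ.
  have -> : a *: v1 + b *: v2 - ((m1 * a) *: v1 + (m2 * b) *: v2) =
      ((1 - m1) * a) *: v1 + ((1 - m2) * b) *: v2.
    by rewrite !mulrBl !mul1r !scalerBl opprD addrACA.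
  rewrite !dotvDZ_orth// -/s1 -/s2; congr (_ / _); rewrite /D; ring.
rewrite AA_stepE alphaE !MZ; apply/colP => i; rewrite !mxE.
by rewrite /D; field.
Qed.

(** Each application exchanges the roles of a and b and flips one sign, so the
    second one restores the direction. The quadratic form in the denominator of
    the second step is (m1 b)^2 s2 + (m2 a)^2 s1 up to a nonzero factor, and the
    identity is linear in the inverses of the two forms; it therefore covers
    vanishing forms, whose inverse is 0. *)
Lemma AA_step_twice (R : realType) (n : nat) (M : 'M[R]_n) (m1 m2 a b : R)
    (v1 v2 : 'cV[R]_n) :
  let s1 := dotv v1 v1 in let s2 := dotv v2 v2 in
  m1 != 1 -> m2 != 1 ->
  is_eigenvector M m1 v1 -> is_eigenvector M m2 v2 -> dotv v1 v2 = 0 ->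
  AA_step M (AA_step M (a *: v1 + b *: v2)) =
    ((m2 - m1) ^+ 2 / (((m1 - 1) * a) ^+ 2 * s1 + ((m2 - 1) * b) ^+ 2 * s2) *
     ((m1 * m2) ^+ 2 / ((m1 * b) ^+ 2 * s2 + (m2 * a) ^+ 2 * s1)) *
     ((a * b) ^+ 2 * s1 * s2)) *: (a *: v1 + b *: v2).
Proof.
move=> s1 s2 m1_neq1 m2_neq1 e1 e2 orth.
have s1_neq0 : s1 != 0 by rewrite dotv_eq0; case: e1.
have s2_neq0 : s2 != 0 by rewrite dotv_eq0; case: e2.
rewrite (AA_step_orth a b m1_neq1 m2_neq1 e1 e2 orth) -/s1 -/s2 AA_stepZ.
rewrite (AA_step_orth _ _ m1_neq1 m2_neq1 e1 e2 orth) -/s1 -/s2.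
set E := (m1 * b) ^+ 2 * s2 + _.
have -> : ((m1 - 1) * (m1 * (m2 - 1) * b * s2)) ^+ 2 * s1 +
    ((m2 - 1) * - (m2 * (m1 - 1) * a * s1)) ^+ 2 * s2 =
    ((m1 - 1) * (m2 - 1)) ^+ 2 * s1 * s2 * E by rewrite /E; ring.
(* [field] must not ask for nonzero forms, hence opaque inverses. *)
rewrite [in LHS]invfM; move: (_^-1) (E^-1) => d e.
apply/colP => i; rewrite !mxE; field.
by rewrite s1_neq0 s2_neq0 !subr_eq0 m1_neq1 m2_neq1.
Qed.

Lemma eigenvalue_neq1 (R : realType) (n : nat) (M : 'M[R]_n) (m : R)
    (v : 'cV[R]_n) :
  1%:M - M \in unitmx -> is_eigenvector M m v -> m != 1.
Proof.
move=> uA [v_neq0 Mv]; apply: contraNneq v_neq0 => m1.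
by rewrite -(mulKmx uA v) mulmxBl mul1mx Mv m1 scale1r subrr mulmx0.
Qed.

Theorem theorem4p3 (R : realType) (M : 'M[R]_2) (m1 m2 c1 c2 : R)
    (v1 v2 r0 : 'cV[R]_2)
    (symM : M^T = M) (M_neq0 : M != 0) (unitA : 1%:M - M \in unitmx)
    (eig1 : is_eigenvector M m1 v1) (eig2 : is_eigenvector M m2 v2)
    (orth : dotv v1 v2 = 0) (r0E : r0 = c1 *: v1 + c2 *: v2) :
  (c1 = 0 \/ c2 = 0 -> root_conv_factor (rAA1 M r0) = 0%:E) /\
  (c1 != 0 -> c2 != 0 -> l2norm v1 = l2norm v2 ->
   let eps := c2 / c1 in
   root_conv_factor (rAA1 M r0) =
     (((m2 - m1) ^+ 2 / ((m1 - 1) ^+ 2 + eps ^+ 2 * (m2 - 1) ^+ 2) *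
       ((m1 * m2) ^+ 2 / (m1 ^+ 2 + m2 ^+ 2 / eps ^+ 2))) `^ (4%:R^-1))%:E).
Proof.
have m1_neq1 := eigenvalue_neq1 unitA eig1.
have m2_neq1 := eigenvalue_neq1 unitA eig2.
have step2 := AA_step_twice c1 c2 m1_neq1 m2_neq1 eig1 eig2 orth.
rewrite -r0E in step2; split=> [c0|c1_neq0 c2_neq0 norm12 eps].
  apply: root_conv_factor_rAA1_eq0; rewrite step2.
  have -> : c1 * c2 = 0 by case: c0 => ->; rewrite ?mul0r ?mulr0.
  by rewrite expr0n !mul0r mulr0 scale0r.
have s12 : dotv v1 v1 = dotv v2 v2.
  by apply/eqP; rewrite -eqr_sqrt ?dotv_ge0//; apply/eqP.
set s := dotv v2 v2 in s12 step2.
have s_neq0 : s != 0 by rewrite dotv_eq0; case: eig2.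
apply: root_conv_factor_rAA1.
- by rewrite ?(sqr_ge0, divr_ge0, mulr_ge0, addr_ge0).
- rewrite -dotv_eq0 r0E dotvDZ_orth// s12 -mulrDl mulf_neq0// -!expr2.
  by rewrite paddr_eq0 ?sqr_ge0// !sqrf_eq0 negb_and c1_neq0.
- rewrite step2 s12; congr (_ *: _).
  have -> : ((m1 - 1) * c1) ^+ 2 * s + ((m2 - 1) * c2) ^+ 2 * s =
      c1 ^+ 2 * s * ((m1 - 1) ^+ 2 + eps ^+ 2 * (m2 - 1) ^+ 2).
    by rewrite /eps; field.
  have -> : (m1 * c2) ^+ 2 * s + (m2 * c1) ^+ 2 * s =
      c2 ^+ 2 * s * (m1 ^+ 2 + m2 ^+ 2 / eps ^+ 2).
    by rewrite /eps; field; rewrite c1_neq0 c2_neq0.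
  (* As above, only the inverses of the two sums matter, not the sums. *)
  move: (_ + eps ^+ 2 * _) (_ + _ / eps ^+ 2) => D E.
  rewrite (invfM _ E) (invfM _ D); move: D^-1 E^-1 => d e; field.
  by rewrite c1_neq0 c2_neq0 s_neq0.
Qed.
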